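(* Let $(X,\mathcal{A},\mu)$ be a measure space and let $I$ be an ideal of the ring $\mathcal{M}(X,\mathcal{A})$. Then $L_I^\infty(\mu)$ is the (connected) component of $0$ in $\mathcal{M}(X,\mathcal{A})$ in the $U_{\mu_I}$-topology.
   Context: $X$ is a non-empty set, $\mathcal{A}$ a $\sigma$-algebra on $X$, and $\mu:\mathcal{A}\to[0,\infty]$ a measure. $\mathcal{M}(X,\mathcal{A})$ is the commutative ring with unity of all real-valued $\mathcal{A}$-measurable functions on $X$, with pointwise operations. For $g\in\mathcal{M}(X,\mathcal{A})$, $Z(g)=\{x\in X: g(x)=0\}$, and for an ideal $I$, $Z[I]=\{Z(g): g\in I\}$. Null sets $E$ below are always members of $\mathcal{A}$. $L_I^\infty(\mu)$ is the set of all $f\in\mathcal{M}(X,\mathcal{A})$ for which there exist $Z\in Z[I]$ and $E\subseteq Z$ with $\mu(E)=0$ such that $f$ is bounded on $Z\setminus E$. For $f\in\mathcal{M}(X,\mathcal{A})$ and real $\epsilon>0$, $U_{\mu_I}(f,\epsilon)$ is the set of all $g\in\mathcal{M}(X,\mathcal{A})$ such that $\sup_{x\in Z\setminus E}|f(x)-g(x)|<\epsilon$ for some $Z\in Z[I]$ and some $E\subseteq Z$ with $\mu(E)=0$ (the supremum is taken in $[0,\infty]$). The sets $U_{\mu_I}(f,\epsilon)$ form an open base for a topology on $\mathcal{M}(X,\mathcal{A})$, called the $U_{\mu_I}$-topology. *)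

(* Defs.v *)
From HB Require Import structures.
From mathcomp Require Import all_boot all_order all_algebra.
From mathcomp Require Import all_classical all_reals all_analysis measurable_realfun.

Set Implicit Arguments.
Unset Strict Implicit.
Unset Printing Implicit Defensive.

Import Order.TTheory GRing.Theory Num.Theory.
Import numFieldNormedType.Exports.

Local Open Scope classical_set_scope.
Local Open Scope ring_scope.

(* Ideals may be improper; MathComp's [idealr_closed] excludes the unit
   ideal and is stated for boolean predicates. *)
Definition is_ideal (A : comNzRingType) (I : set A) : Prop :=
  [/\ I 0,
      forall f g, I f -> I g -> I (f + g) &
      forall f g, I g -> I (f * g)].

Section defs.
Context d (T : measurableType d) (R : realType).
Local Notation M := {mfun T >-> R}.

Definition zero_set (g : M) : set T := [set x | g x = 0].

Definition zero_sets (I : set M) : set (set T) := [set zero_set g | g in I].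

(* The point [0] makes the supremum that of [0, +oo], so that it is [0] (and
   not [-oo]) over the empty set. *)
Definition sup_dist (f g : M) (A : set T) : \bar R :=
  ereal_sup (0%E |` [set `|f x - g x|%:E | x in A]).

Context (mu : {measure set T -> \bar R}).

Definition LIoo (I : set M) : set M :=
  [set f | exists Z E, [/\ zero_sets I Z, E `<=` Z,
    measurable E, mu E = 0%E & [bounded f x | x in Z `\` E]]].

Definition UmuI (I : set M) (f : M) (eps : R) : set M :=
  [set g | exists Z E, [/\ zero_sets I Z, E `<=` Z,
    measurable E, mu E = 0%E & (sup_dist f g (Z `\` E) < eps%:E)%E]].

Lemma sup_dist_ltP f g A (eps : R) : 0 < eps ->
  (sup_dist f g A < eps%:E)%E <->
  exists r, [/\ 0 <= r, r < eps & forall x, A x -> `|f x - g x| <= r].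
Proof.
move=> eps0; split=> [lt_eps|[r [r0 reps fgr]]]; last first.
  apply: (@le_lt_trans _ _ r%:E); last by rewrite lte_fin.
  by apply: ge_ereal_sup => _ [->|[x Ax <-]]; rewrite lee_fin//; exact: fgr.
have sup0 : (0 <= sup_dist f g A)%E by apply: ereal_sup_ubound; left.
have supf : sup_dist f g A \is a fin_num.
  by rewrite ge0_fin_numE// (lt_trans lt_eps)// ltry.
exists (fine (sup_dist f g A)); split.
- exact: fine_ge0.
- by rewrite -lte_fin fineK.
- move=> x Ax; rewrite -lee_fin fineK//.
  by apply: ereal_sup_ubound; right; exists x.
Qed.

Lemma zero_setsI (I : set M) Z1 Z2 : is_ideal I ->
  zero_sets I Z1 -> zero_sets I Z2 -> zero_sets I (Z1 `&` Z2).
Proof.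
move=> [_ ID IM] [a Ia <-] [b Ib <-]; exists (a * a + b * b).
  by apply: ID; exact: IM.
apply/seteqP; split=> x; rewrite /zero_set /=.
  rewrite -[LHS]/(a x * a x + b x * b x) => /eqP; rewrite -!expr2 paddr_eq0 ?sqr_ge0//.
  by rewrite !sqrf_eq0 => /andP[/eqP -> /eqP ->].
by move=> [a0 b0]; rewrite -[LHS]/(a x * a x + b x * b x) a0 b0 !mulr0 addr0.
Qed.

Lemma UmuI_refl I f eps : is_ideal I -> 0 < eps -> UmuI I f eps f.
Proof.
move=> [I0 _ _] eps0; exists (zero_set 0), set0; split => //.
- by exists 0.
- apply/sup_dist_ltP => //; exists 0; split=> // x _.
  by rewrite subrr normr0.
Qed.

Lemma UmuI_sub I f g eps : is_ideal I -> 0 < eps -> UmuI I f eps g ->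
  exists2 del, 0 < del & UmuI I g del `<=` UmuI I f eps.
Proof.
move=> HI eps0 [Z1 [E1 [Z1I E1Z1 mE1 E10 /(sup_dist_ltP _ _ _ eps0)]]].
move=> [r [r0 reps fgr]].
exists (eps - r); first by rewrite subr_gt0.
move=> h [Z2 [E2 [Z2I E2Z2 mE2 E20]]].
have del0 : 0 < eps - r by rewrite subr_gt0.
move=> /(sup_dist_ltP _ _ _ del0)[s [s0 seps ghs]].
have mZ Z : zero_sets I Z -> measurable Z.
  move=> [a _ <-]; rewrite (_ : zero_set a = setT `&` a @^-1` [set 0]).
    by apply: measurable_funPT => //; exact: measurable_set1.
  by rewrite setTI.
have Z12I := zero_setsI HI Z1I Z2I.
exists (Z1 `&` Z2), ((E1 `|` E2) `&` (Z1 `&` Z2)); split=> //.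
- by apply: measurableI; [exact: measurableU|exact: mZ].
- have mE : measurable (E1 `|` E2) by exact: measurableU.
  apply/eqP; rewrite eq_le measure_ge0 andbT.
  apply: (@le_trans _ _ (mu (E1 `|` E2))).
    by apply: le_measure; rewrite ?inE//; apply: measurableI => //; exact: mZ.
  by rewrite measureU0// E10.
- apply/(sup_dist_ltP _ _ _ eps0); exists (r + s); split.
  + exact: addr_ge0.
  + by rewrite addrC -ltrBrDr.
  + move=> x [[Z1x Z2x] nE].
    rewrite (le_trans (ler_distD (g x) _ _))// lerD//.
      by apply: fgr; split=> // E1x; apply: nE; split=> //; left.
    by apply: ghs; split=> // E2x; apply: nE; split=> //; right.
Qed.

Lemma UmuI_le I f del eps : del <= eps -> UmuI I f del `<=` UmuI I f eps.
Proof.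
move=> de g [Z [E [ZI EZ mE E0 lt]]]; exists Z, E; split=> //.
by rewrite (lt_le_trans lt)// lee_fin.
Qed.

(* An alias of M carrying the U_{mu_I}-topology. The parameters [nu] and [HI]
   are phantom: [nu] records the measure that determines the topology, and [HI]
   is what makes the sets [UmuI nu I f eps] a base. *)
Definition UmuI_space (nu : {measure set T -> \bar R}) (I : set M)
  (HI : is_ideal I) : Type := M.

Section topology.
Variables (I : set M) (HI : is_ideal I).

HB.instance Definition _ := Choice.on (UmuI_space mu HI).
HB.instance Definition _ := isPointed.Build (UmuI_space mu HI) (0 : M).

Let base_dom : set (UmuI_space mu HI * R) := [set i | 0 < i.2].
Let base_set (i : UmuI_space mu HI * R) : set (UmuI_space mu HI) := UmuI I i.1 i.2.

Let base_cover : \bigcup_(i in base_dom) base_set i = setT.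
Proof.
apply/seteqP; split=> // f _; exists (f, 1); first exact: ltr01.
exact: (UmuI_refl f HI ltr01).
Qed.

Let base_join i j t : base_dom i -> base_dom j -> base_set i t ->
  base_set j t -> exists k, [/\ base_dom k, base_set k t &
                                base_set k `<=` base_set i `&` base_set j].
Proof.
move=> i0 j0 /(UmuI_sub HI i0)[a a0 ai] /(UmuI_sub HI j0)[b b0 bj].
have ab0 : 0 < Num.min a b by rewrite lt_min a0 b0.
exists (t, Num.min a b); split=> //.
  exact: (UmuI_refl (t : M) HI ab0).
move=> g tg; split.
- by apply/ai/(UmuI_le _ tg); rewrite /= ge_min lexx.
- by apply/bj/(UmuI_le _ tg); rewrite /= ge_min lexx orbT.
Qed.

HB.instance Definition _ :=
  @isBaseTopological.Build (UmuI_space mu HI) _ base_dom base_set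
    base_cover base_join.

End topology.

End defs.

Lemma UmuI_openP d (T : measurableType d) (R : realType)
    (mu : {measure set T -> \bar R}) (I : set {mfun T >-> R})
    (HI : is_ideal I) (U : set (UmuI_space mu HI)) :
  open U <-> forall f : {mfun T >-> R}, U f ->
    exists2 eps : R, 0 < eps & UmuI mu I f eps `<=` U.
Proof.
split=> [[D' D'D <-] f [i D'i fi]|Uopen].
  have [eps eps0 epsi] := UmuI_sub HI (D'D _ D'i) fi.
  by exists eps => // g /epsi gi; exists i.
exists [set i | 0 < i.2 /\ UmuI mu I i.1 i.2 `<=` U].
  by move=> i [].
apply/seteqP; split=> [f [i [_ iU]] /iU//|f Uf].
have [eps eps0 epsU] := Uopen _ Uf.
by exists (f, eps); [split|exact: (UmuI_refl mu f HI eps0)].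
Qed.

(* Main.v *)
Require Import Defs.
From mathcomp Require Import all_boot all_order all_algebra.
From mathcomp Require Import all_classical all_reals all_analysis measurable_realfun.

(** The sets [UmuI mu I f eps] behave like the balls of an extended
pseudometric: they are symmetric ([UmuI_sym]) and satisfy the triangle
inequality ([UmuI_triangle]), because zero sets of members of an ideal are
stable under intersection and null sets under union. In these terms
[LIoo mu I] consists of the functions at finite distance from [0]
([LIoo_UmuIP]).

Being at finite distance is an equivalence relation each of whose classes
contains the ball of radius [1] around each of its points; hence [LIoo mu I]
is clopen, and a connected set that contains [0] cannot leave it.

Conversely, if [f] is bounded on [Z `\` E] then the line [t |-> t f] is
Lipschitz for this distance, hence continuous ([continuous_line]), and the
image of [[0, 1]] is a connected set joining [0] to [f]. *)

Import Order.TTheory GRing.Theory Num.Theory.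
Import numFieldNormedType.Exports.

Local Open Scope classical_set_scope.
Local Open Scope ring_scope.

Section UmuI_balls.
Context {d : measure_display} {T : measurableType d} {R : realType}.
Variables (mu : {measure set T -> \bar R}) (I : set {mfun T >-> R}).
Implicit Types (f g h : {mfun T >-> R}) (Z : set T) (eps r s : R).

Lemma measurable_zero_sets Z : zero_sets I Z -> measurable Z.
Proof.
move=> [a _ <-]; rewrite -[zero_set a]setTI.
exact: (measurable_funPT a measurableT [set 0] (measurable_set1 0)).
Qed.

Lemma UmuI_sym f g eps : UmuI mu I f eps g -> UmuI mu I g eps f.
Proof.
move=> [Z [E [ZI EZ mE E0 lt_eps]]]; exists Z, E; split=> //.
by rewrite /sup_dist; under eq_imagel do rewrite distrC.
Qed.

(** A bound valid on [Z1 `\` E1] and one valid on [Z2 `\` E2] hold together on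
[(Z1 `&` Z2) `\` (E1 `|` E2)]; cutting [E1 `|` E2] down to [Z1 `&` Z2] makes it
an admissible exceptional set. *)
Lemma UmuI_triangle (HI : is_ideal I) f g h r s : 0 < r -> 0 < s ->
  UmuI mu I f r g -> UmuI mu I g s h -> UmuI mu I f (r + s) h.
Proof.
move=> r0 s0.
move=> [Z1 [E1 [Z1I E1Z1 mE1 E10 /(sup_dist_ltP _ _ _ r0)[a [a0 ar fga]]]]].
move=> [Z2 [E2 [Z2I E2Z2 mE2 E20 /(sup_dist_ltP _ _ _ s0)[b [b0 bs ghb]]]]].
have Z12I := zero_setsI HI Z1I Z2I.
have mZ12 := measurable_zero_sets _ Z12I.
have mE : measurable (E1 `|` E2) by exact: measurableU.
have E0 : mu (E1 `|` E2) = 0%E by rewrite measureU0.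
exists (Z1 `&` Z2), ((E1 `|` E2) `&` (Z1 `&` Z2)); split=> //.
- exact: measurableI.
- by apply: subset_measure0 E0 => //; exact: measurableI.
- apply/sup_dist_ltP; first exact: addr_gt0.
  exists (a + b); split; [exact: addr_ge0|exact: ltrD|].
  move=> x [[Z1x Z2x] nE].
  rewrite (le_trans (ler_distD (g x) _ _))// lerD//.
    by apply: fga; split=> // E1x; apply: nE; split=> //; left.
  by apply: ghb; split=> // E2x; apply: nE; split=> //; right.
Qed.

Lemma LIoo_UmuIP f : LIoo mu I f <-> exists2 r, 0 < r & UmuI mu I 0 r f.
Proof.
split=> [[Z [E [ZI EZ mE E0 bf]]]|[r r0 [Z [E [ZI EZ mE E0]]]]].
  have [M M0 fM] := pinfty_ex_gt0 bf.
  exists (M + 1); first exact: addr_gt0.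
  exists Z, E; split=> //; apply/sup_dist_ltP; first exact: addr_gt0.
  exists M; split; [exact: ltW|by rewrite ltrDl|].
  by move=> x ZEx; rewrite sub0r normrN; exact: fM.
move=> /(sup_dist_ltP _ _ _ r0)[a [a0 ar fa]].
exists Z, E; split=> //; exists a; split; first exact: num_real.
move=> M aM x ZEx /=; rewrite (le_trans _ (ltW aM))//.
by have := fa x ZEx; rewrite sub0r normrN.
Qed.

(** This makes [LIoo mu I] a neighbourhood of each of its points and, by
[UmuI_sym], its complement too; the radius [1] is uniform in [f], which is what
the passage to the complement needs. *)
Lemma LIoo_UmuI1 (HI : is_ideal I) f g :
  UmuI mu I f 1 g -> LIoo mu I f -> LIoo mu I g.
Proof.
move=> fg /LIoo_UmuIP[r r0 fr]; apply/LIoo_UmuIP; exists (r + 1).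
  exact: addr_gt0.
exact: (UmuI_triangle HI _ f).
Qed.

Lemma open_LIoo (HI : is_ideal I) : open (LIoo mu I : set (UmuI_space mu HI)).
Proof.
apply/UmuI_openP => f fL; exists 1 => // g fg.
exact: LIoo_UmuI1 fg fL.
Qed.

Lemma closed_LIoo (HI : is_ideal I) : closed (LIoo mu I : set (UmuI_space mu HI)).
Proof.
rewrite -openC; apply/UmuI_openP => f nfL; exists 1 => // g fg gL; apply: nfL.
exact: LIoo_UmuI1 (UmuI_sym _ _ _ fg) gL.
Qed.

Definition line (HI : is_ideal I) f (t : R) : UmuI_space mu HI :=
  (cst t * f : {mfun T >-> R}).

(** If [`|f|] is bounded by [a] on [Z `\` E], then [`|t f - s f| <= `|t - s| a]
there. *)
Lemma continuous_line (HI : is_ideal I) f :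
  LIoo mu I f -> continuous (line HI f).
Proof.
move=> /LIoo_UmuIP[r r0 [Z [E [ZI EZ mE E0]]]].
move=> /(sup_dist_ltP _ _ _ r0)[a [a0 ar fa]].
move=> t B; rewrite nbhsE => -[U [Uo Ut] UB].
have [eps eps0 epsU] := (UmuI_openP U).1 Uo _ Ut.
change (\forall s \near t, B (line HI f s)).
near=> s; apply/UB/epsU; exists Z, E; split=> //.
apply/sup_dist_ltP => //; exists (`|t - s| * a); split.
- by rewrite mulr_ge0.
- (* [a] may vanish, so the modulus is taken with respect to [r > a]. *)
  rewrite (@le_lt_trans _ _ (`|t - s| * r))//.
    by rewrite ler_wpM2l// ltW.
  rewrite -ltr_pdivlMr//.
  near: s; apply: (@cvgr_dist_lt _ _ _ (nbhs t) _ id) => //.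
  exact: divr_gt0.
- move=> x ZEx.
  rewrite -[X in `|X|]/(t * f x - s * f x) -mulrBl normrM ler_wpM2l//.
  by have := fa x ZEx; rewrite sub0r normrN.
Unshelve. all: by end_near. Qed.

End UmuI_balls.

Theorem theorem3p3 (d : measure_display) (T : measurableType d) (R : realType)
    (mu : {measure set T -> \bar R}) (I : set {mfun T >-> R})
    (HI : is_ideal I) :
  connected_component [set: UmuI_space mu HI] (0 : {mfun T >-> R}) = LIoo mu I.
Proof.
apply/seteqP; split=> f.
  move=> [C [C0 _ Cc] Cf].
  suff CL : C `&` LIoo mu I = C by move: Cf; rewrite -CL => -[].
  apply: Cc.
  - exists 0; split=> //; apply/LIoo_UmuIP; exists 1 => //.
    exact: UmuI_refl.
  - by exists (LIoo mu I) => //; exact: open_LIoo.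
  - by exists (LIoo mu I) => //; exact: closed_LIoo.
move=> fL.
exists (line mu I HI f @` `[0, 1]); last first.
  exists 1; first by rewrite /= in_itv /= ler01 lexx.
  by apply/mfuneqP => x; rewrite -[LHS]/(1 * f x) mul1r.
split=> //.
  exists 0; first by rewrite /= in_itv /= ler01 lexx.
  by apply/mfuneqP => x; rewrite -[LHS]/(0 * f x) mul0r.
apply: connected_continuous_connected; first exact: segment_connected.
by apply: continuous_subspaceT; exact: continuous_line.
Qed.
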